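(* Let $\Lambda$ and $\Lambda'$ be finite-dimensional elementary $k$-algebras of rank $2$ with complete sets of primitive orthogonal idempotents $1=e_1+e_2\in\Lambda$ and $1=e'_1+e'_2\in\Lambda'$, such that $e_2\Lambda e_1=0$ and $e'_1\Lambda'e'_2=0$ (equivalently, $\Sigma(\Lambda)\in\mathsf{Fan}^{+-}_{\rm sc}(2)$ and $\Sigma(\Lambda')\in\mathsf{Fan}^{-+}_{\rm sc}(2)$). Then there exists a finite-dimensional elementary $k$-algebra $\Gamma$ of rank $2$ (with a complete set of primitive orthogonal idempotents $1=f_1+f_2$) such that $\Sigma(\Gamma)=\Sigma(\Lambda)\ast\Sigma(\Lambda')$.
   Context: $k$ is a field. Elementary: $\Lambda/J_\Lambda$ is isomorphic to a product of copies of $k$. The $g$-fan $\Sigma(\Lambda)$ is the set of cones $\operatorname{cone}\{[T_1],\dots,[T_m]\}$ for basic 2-term presilting complexes $T=\bigoplus T_i$ (indecomposable $T_i$) in $K^b(\operatorname{proj}\Lambda)$, where 2-term means concentrated in degrees $-1,0$, presilting means $\operatorname{Hom}(T,T[\ell])=0$ for $\ell>0$, and $[T]=[T^0]-[T^{-1}]$; it is viewed in $\mathbb{R}^2$ via $[e_1\Lambda]\mapsto(1,0)$, $[e_2\Lambda]\mapsto(0,1)$ (similarly for $\Lambda'$ and $\Gamma$ with their idempotents). $\mathsf{Fan}^{+-}_{\rm sc}(2)$ (resp. $\mathsf{Fan}^{-+}_{\rm sc}(2)$) denotes sign-coherent fans of rank 2 containing $\sigma_{-+}=\operatorname{cone}\{(-1,0),(0,1)\}$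 (resp. $\sigma_{+-}=\operatorname{cone}\{(1,0),(0,-1)\}$). For $\Sigma\in\mathsf{Fan}^{+-}_{\rm sc}(2)$ and $\Sigma'\in\mathsf{Fan}^{-+}_{\rm sc}(2)$, $\Sigma\ast\Sigma'$ is the fan with rays $\Sigma_1\cup\Sigma'_1$ and 2-dimensional cones $(\Sigma_2\setminus\{\sigma_{-+}\})\cup(\Sigma'_2\setminus\{\sigma_{+-}\})$ (together with their faces). *)

(* Defs.v *)
From HB Require Import structures.
From mathcomp Require Import all_boot all_order all_algebra falgebra.
From mathcomp Require Import reals.


Unset Printing Implicit Defensive.
Import Order.TTheory GRing.Theory Num.Theory.
Local Open Scope ring_scope.

Definition idempotent {k : fieldType} {A : falgType k} (e : A) : Prop :=
  e * e = e.

Definition primitive_idem {k : fieldType} {A : falgType k} (e : A) : Prop :=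
  idempotent e /\ e <> 0 /\
  ~ (exists a b : A, idempotent a /\ idempotent b /\ a <> 0 /\ b <> 0 /\
       a * b = 0 /\ b * a = 0 /\ a + b = e).

Definition complete_prim_orth2 {k : fieldType} {A : falgType k} (e1 e2 : A) : Prop :=
  primitive_idem e1 /\ primitive_idem e2 /\ e1 * e2 = 0 /\ e2 * e1 = 0 /\
  e1 + e2 = 1.

Definition jacobson {k : fieldType} {A : falgType k} (x : A) : Prop :=
  forall y : A, exists z : A, (1 - x * y) * z = 1 /\ z * (1 - x * y) = 1.

Definition kalg_char {k : fieldType} {A : falgType k} (phi : A -> k) : Prop :=
  (forall (c : k) (x y : A), phi (c *: x + y) = c * phi x + phi y) /\
  (forall x y : A, phi (x * y) = phi x * phi y) /\ phi 1 = 1.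

(* elementary of rank 2: A / J_A is isomorphic, as a k-algebra, to k x k.
   The isomorphism is given by the two components phi1, phi2 of a surjective
   k-algebra map A -> k x k with kernel J_A. *)
Definition elementary_rank2 {k : fieldType} (A : falgType k) : Prop :=
  exists phi1 phi2 : A -> k, kalg_char phi1 /\ kalg_char phi2 /\
    (forall a b : k, exists x : A, phi1 x = a /\ phi2 x = b) /\
    (forall x : A, (phi1 x = 0 /\ phi2 x = 0) <-> jacobson x).

(* A finitely generated projective module is modelled as a direct sum       *)
(* (+)_j e_{s j} A, s : 'I_m -> 'I_2; a morphism (+)_j e_{t j} A ->         *)
(* (+)_i e_{s i} A is a matrix M with M i j in e_{s i} A e_{t j} (acting by *)
(* left multiplication), composition is matrix product.                     *)

Definition eidx {k : fieldType} {A : falgType k} (e1 e2 : A) (i : 'I_2) : A :=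
  if i == ord0 then e1 else e2.

Definition adm {k : fieldType} {A : falgType k} (e1 e2 : A) {a b : nat}
  (s : 'I_a -> 'I_2) (t : 'I_b -> 'I_2) (M : 'M[A]_(a, b)) : Prop :=
  forall i j, M i j = eidx e1 e2 (s i) * M i j * eidx e1 e2 (t j).

Definition idm {k : fieldType} {A : falgType k} (e1 e2 : A) {a : nat}
  (s : 'I_a -> 'I_2) : 'M[A]_a :=
  \matrix_(i, j) (if i == j then eidx e1 e2 (s i) else 0).

(* 2-term complex  T^{-1} --d--> T^0, T^{-1} = (+)_j e_{cp j} A,
   T^0 = (+)_i e_{cq i} A *)
Record cx (A : Type) := Cx {
  cm : nat; cn : nat;
  cp : 'I_cm -> 'I_2; cq : 'I_cn -> 'I_2;
  cd : 'M[A]_(cn, cm) }.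
Arguments cm {A} c.
Arguments cn {A} c.
Arguments cp {A} c _.
Arguments cq {A} c _.
Arguments cd {A} c.

Definition valid_cx {k : fieldType} {A : falgType k} (e1 e2 : A) (T : cx A) : Prop :=
  adm e1 e2 (cq T) (cp T) (cd T).

Definition zero_cx {k : fieldType} (A : falgType k) : cx A :=
  @Cx A 0 0 (fun _ => ord0) (fun _ => ord0) 0.

Definition sumf {a b : nat} (s : 'I_a -> 'I_2) (t : 'I_b -> 'I_2) (i : 'I_(a + b)) : 'I_2 :=
  match split i with inl x => s x | inr y => t y end.

Definition dsum_cx {k : fieldType} {A : falgType k} (T1 T2 : cx A) : cx A :=
  @Cx A (cm T1 + cm T2) (cn T1 + cn T2)
     (sumf (cp T1) (cp T2)) (sumf (cq T1) (cq T2))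
     (block_mx (cd T1) 0 0 (cd T2)).

Definition chain_map {k : fieldType} {A : falgType k} (e1 e2 : A) (T T' : cx A)
  (f1 : 'M[A]_(cm T', cm T)) (f0 : 'M[A]_(cn T', cn T)) : Prop :=
  adm e1 e2 (cp T') (cp T) f1 /\ adm e1 e2 (cq T') (cq T) f0 /\
  cd T' *m f1 = f0 *m cd T.

Definition homotopic {k : fieldType} {A : falgType k} (e1 e2 : A) (T T' : cx A)
  (f1 g1 : 'M[A]_(cm T', cm T)) (f0 g0 : 'M[A]_(cn T', cn T)) : Prop :=
  exists h : 'M[A]_(cm T', cn T), adm e1 e2 (cp T') (cq T) h /\
    f1 - g1 = h *m cd T /\ f0 - g0 = cd T' *m h.

Definition iso_K {k : fieldType} {A : falgType k} (e1 e2 : A) (T T' : cx A) : Prop :=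
  exists (f1 : 'M[A]_(cm T', cm T)) (f0 : 'M[A]_(cn T', cn T))
         (g1 : 'M[A]_(cm T, cm T')) (g0 : 'M[A]_(cn T, cn T')),
    chain_map e1 e2 T T' f1 f0 /\ chain_map e1 e2 T' T g1 g0 /\
    homotopic e1 e2 T T (g1 *m f1) (idm e1 e2 (cp T)) (g0 *m f0) (idm e1 e2 (cq T)) /\
    homotopic e1 e2 T' T' (f1 *m g1) (idm e1 e2 (cp T')) (f0 *m g0) (idm e1 e2 (cq T')).

Definition indec_K {k : fieldType} {A : falgType k} (e1 e2 : A) (T : cx A) : Prop :=
  ~ iso_K e1 e2 T (zero_cx A) /\
  forall U V : cx A, valid_cx e1 e2 U -> valid_cx e1 e2 V ->
    iso_K e1 e2 T (dsum_cx U V) ->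
    iso_K e1 e2 U (zero_cx A) \/ iso_K e1 e2 V (zero_cx A).

(* Hom_{K^b(proj A)}(T, T'[1]) = 0: every g : T^{-1} -> T'^0 is null-homotopic,
   i.e. g = d' a + b d with a : T^{-1} -> T'^{-1}, b : T^0 -> T'^0.
   (For 2-term complexes Hom(T, T'[l]) = 0 automatically for l >= 2.) *)
Definition hom_shift1_zero {k : fieldType} {A : falgType k} (e1 e2 : A) (T T' : cx A) : Prop :=
  forall g : 'M[A]_(cn T', cm T), adm e1 e2 (cq T') (cp T) g ->
    exists (a : 'M[A]_(cm T', cm T)) (b : 'M[A]_(cn T', cn T)),
      adm e1 e2 (cp T') (cp T) a /\ adm e1 e2 (cq T') (cq T) b /\
      g = cd T' *m a + b *m cd T.

(* g-vector [T] = [T^0] - [T^{-1}], with [e1 A] |-> (1,0), [e2 A] |-> (0,1) *)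
Definition gcoord {A : Type} {R : realType} (T : cx A) (i : 'I_2) : R :=
  (#|[pred j | cq T j == i]|)%:R - (#|[pred j | cp T j == i]|)%:R.

Definition gvec {A : Type} {R : realType} (T : cx A) : R * R :=
  (gcoord T ord0, gcoord T ord_max).

Definition cone {R : realType} {r : nat} (g : 'I_r -> R * R) : R * R -> Prop :=
  fun v => exists l : 'I_r -> R, (forall i, 0 <= l i) /\
    v = (\sum_i l i * (g i).1, \sum_i l i * (g i).2).

Definition fan (R : realType) := (R * R -> Prop) -> Prop.

(* g-fan Sigma(A), w.r.t. the idempotents e1, e2: the cones
   cone{[T_1],...,[T_r]} for basic 2-term presilting T = T_1 (+) ... (+) T_r
   (T_i indecomposable, pairwise non-isomorphic). Presilting of the sum is
   expressed summandwise: Hom(T_i, T_j[1]) = 0 for all i, j. *)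
Definition gfan (R : realType) {k : fieldType} {A : falgType k} (e1 e2 : A) : fan R :=
  fun C => exists (r : nat) (T : 'I_r -> cx A),
    (forall i, valid_cx e1 e2 (T i) /\ indec_K e1 e2 (T i)) /\
    (forall i j, i != j -> ~ iso_K e1 e2 (T i) (T j)) /\
    (forall i j, hom_shift1_zero e1 e2 (T i) (T j)) /\
    C = cone (fun i => gvec (R := R) (T i)).

Definition dim_le1 {R : realType} (C : R * R -> Prop) : Prop :=
  exists v : R * R, forall x, C x -> exists t : R, x = (t * v.1, t * v.2).
Definition dim_eq2 {R : realType} (C : R * R -> Prop) : Prop := ~ dim_le1 C.

Definition vec2 {R : realType} (a b c d : R) : 'I_2 -> R * R :=
  fun i => if i == ord0 then (a, b) else (c, d).

Definition sigma_mp (R : realType) : R * R -> Prop := cone (vec2 (-1) 0 0 1).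
Definition sigma_pm (R : realType) : R * R -> Prop := cone (vec2 1 0 0 (-1)).

(* Sigma * Sigma': cones of dimension <= 1 (zero cone and rays) of Sigma and
   Sigma', together with (Sigma_2 \ {sigma_-+}) u (Sigma'_2 \ {sigma_+-}).
   (The faces of these 2-dimensional cones are cones of dimension <= 1 of
   Sigma resp. Sigma', which are fans, so they are already included.) *)
Definition fan_star {R : realType} (S S' : fan R) : fan R :=
  fun C => (S C /\ dim_le1 C) \/ (S' C /\ dim_le1 C) \/
           (S C /\ dim_eq2 C /\ C <> sigma_mp R) \/
           (S' C /\ dim_eq2 C /\ C <> sigma_pm R).

(* Main.v *)
(** Let phi_1, phi_2 be the characters of L with phi_i(e_j) = delta_ij, and
    phi'_1, phi'_2 those of L'.  Take for G the fibre product of L and L' over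
    k x k, that is, the pairs (x, x') with phi_i(x) = phi'_i(x').  The projection
    G -> L has the multiplicative section x |-> (x, phi_1(x) e'_1 + phi_2(x) e'_2),
    and the composite G -> L -> G is the identity on f_1 G f_2 because
    e'_1 L' e'_2 = 0; symmetrically for L' and f_2 G f_1.

    Over any of the three algebras, Gaussian elimination replaces a 2-term complex
    by a homotopy equivalent one whose differential is radical.  For such complexes,
    Hom(T, T'[1]) = 0 forces T^(-1) and T'^0 to have no common summand, so a
    presilting family over G consists either of complexes with differentials in
    f_1 G f_2 (or with one term zero) or of complexes with differentials in
    f_2 G f_1.  The first kind is the same over G and over L, the second the same
    over G and over L'.  Over L the second kind has zero differentials, hence
    contributes only sigma_-+ and its faces. *)

Require Import Defs.
From HB Require Import structures.
From mathcomp Require Import all_boot all_order all_algebra falgebra.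
From mathcomp Require Import reals.
From mathcomp Require Import boolp.
Set Implicit Arguments.
Unset Strict Implicit.
Import Order.TTheory GRing.Theory Num.Theory.
Local Open Scope ring_scope.

(** * Characters and idempotents *)

(** The form in which the hypotheses on an algebra are used: the characters are numbered to match
    the idempotents. The field [split_rad] has no second factor as in [jacobson], because the common
    kernel of the characters is an ideal. *)
Record split_idem {k : fieldType} {A : falgType k} (e1 e2 : A)
    (phi : 'I_2 -> A -> k) : Prop := SplitIdem {
  split_char : forall c, kalg_char (phi c);
  split_phi : forall c d, phi c (eidx e1 e2 d) = (c == d)%:R;
  split_orth : forall c d, eidx e1 e2 c * eidx e1 e2 d =
                           if c == d then eidx e1 e2 c else 0;
  split_sum : e1 + e2 = 1;
  split_rad : forall x, (forall c, phi c x = 0) ->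
    exists z, (1 - x) * z = 1 /\ z * (1 - x) = 1 }.

Definition oidx (c : 'I_2) : 'I_2 := if c == ord0 then ord_max else ord0.

Lemma I2P (P : 'I_2 -> Prop) : P ord0 -> P ord_max -> forall c, P c.
Proof.
move=> P0 P1 [[|[|//]] lt_c].
  by rewrite (_ : Ordinal lt_c = ord0) //; apply: val_inj.
by rewrite (_ : Ordinal lt_c = ord_max) //; apply: val_inj.
Qed.

Lemma oidx_neq c : oidx c != c.
Proof. by move: c; apply: I2P. Qed.

Lemma oidxK : involutive oidx.
Proof. by apply: I2P. Qed.

Lemma neq_oidx c d : c != d -> c = oidx d.
Proof. by move: c d; do 2!apply: I2P. Qed.

Section Characters.
Context {k : fieldType} {A : falgType k} {phi : A -> k}.
Hypothesis chi : kalg_char phi.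

Lemma charD x y : phi (x + y) = phi x + phi y.
Proof. by case: chi => lin _; have := lin 1 x y; rewrite scale1r mul1r. Qed.

Lemma char0 : phi 0 = 0.
Proof. by apply: (addrI (phi 0)); rewrite -charD !addr0. Qed.

Lemma charN x : phi (- x) = - phi x.
Proof. by apply/eqP; rewrite -addr_eq0 -charD addNr char0. Qed.

Lemma charB x y : phi (x - y) = phi x - phi y.
Proof. by rewrite charD charN. Qed.

Lemma charZ a x : phi (a *: x) = a * phi x.
Proof. by case: chi => lin _; have := lin a x 0; rewrite char0 !addr0. Qed.

Lemma charM x y : phi (x * y) = phi x * phi y.
Proof. by case: chi => _ []. Qed.

Lemma char1 : phi 1 = 1.
Proof. by case: chi => _ []. Qed.

Lemma char_mulmx_eq0 a b c (M : 'M[A]_(a, b)) (N : 'M[A]_(b, c)) i j :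
  (forall l, phi (M i l) = 0 \/ phi (N l j) = 0) -> phi ((M *m N) i j) = 0.
Proof.
move=> MN0; rewrite mxE (big_morph phi charD char0) big1 // => l _.
by rewrite charM; case: (MN0 l) => ->; rewrite ?mul0r ?mulr0.
Qed.

Lemma char_idem x : Defs.idempotent x -> (phi x = 0) \/ (phi x = 1).
Proof.
rewrite /Defs.idempotent => xx; have /eqP: phi x * (phi x - 1) = 0.
  by rewrite mulrBr mulr1 -charM xx subrr.
by rewrite mulf_eq0 subr_eq0 => /orP[] /eqP; [left | right].
Qed.

End Characters.

(** By [split_jacobson] this says that the differential is radical. *)
Definition minimal {k : fieldType} {A : falgType k} (phi : 'I_2 -> A -> k)
    (T : cx A) : Prop :=
  forall c i j, phi c (cd T i j) = 0.

(** * The homotopy category of 2-term complexes *)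

Section HomotopyCategory.
Context {k : fieldType} {A : falgType k} {e1 e2 : A} {phi : 'I_2 -> A -> k}.
Hypothesis sp : split_idem e1 e2 phi.
Notation e := (eidx e1 e2).
Notation adm := (adm e1 e2).
Notation idm := (idm e1 e2).
Notation iso := (iso_K e1 e2).
Notation valid := (valid_cx e1 e2).

Lemma eidxK c : e c * e c = e c.
Proof. by rewrite (split_orth sp) eqxx. Qed.

Lemma eidx_mulm c x d : e c * (e c * x * e d) * e d = e c * x * e d.
Proof. by rewrite !mulrA eidxK -mulrA eidxK. Qed.

Section Adm.
Context {a b : nat} {s : 'I_a -> 'I_2} {t : 'I_b -> 'I_2}.
Implicit Types M N : 'M[A]_(a, b).

Lemma admL M i j : adm s t M -> e (s i) * M i j = M i j.
Proof. by move=> sM; rewrite (sM i j) !mulrA eidxK. Qed.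

Lemma admR M i j : adm s t M -> M i j * e (t j) = M i j.
Proof. by move=> sM; rewrite (sM i j) -!mulrA eidxK. Qed.

Lemma admP M : (forall i j, e (s i) * M i j = M i j) ->
  (forall i j, M i j * e (t j) = M i j) -> adm s t M.
Proof. by move=> ML MR i j; rewrite ML MR. Qed.

Lemma adm0 : adm s t 0.
Proof. by move=> i j; rewrite !mxE mulr0 mul0r. Qed.

Lemma admD M N : adm s t M -> adm s t N -> adm s t (M + N).
Proof. by move=> sM sN i j; rewrite !mxE mulrDr mulrDl -sM -sN. Qed.

Lemma admN M : adm s t M -> adm s t (- M).
Proof. by move=> sM i j; rewrite !mxE mulrN mulNr -sM. Qed.

Lemma adm_idl M : adm s t M -> idm s *m M = M.
Proof.
move=> sM; apply/matrixP=> i j; rewrite mxE (bigD1 i) //= mxE eqxx admL //.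
by rewrite big1 ?addr0 // => l /negPf li; rewrite mxE eq_sym li mul0r.
Qed.

Lemma adm_idr M : adm s t M -> M *m idm t = M.
Proof.
move=> sM; apply/matrixP=> i j; rewrite mxE (bigD1 j) //= mxE eqxx admR //.
by rewrite big1 ?addr0 // => l /negPf lj; rewrite mxE lj mulr0.
Qed.

(** The entry lies between two idempotents, and phi_c kills it unless both are e_c. A non-radical
    entry thus joins equal summands and can serve as a pivot. *)
Lemma adm_phi_neq0 M c i j : adm s t M -> phi c (M i j) != 0 -> s i = c /\ t j = c.
Proof.
move=> sM; rewrite (sM i j) !(charM (split_char sp c)) !(split_phi sp).
have [<-|_] := eqVneq c (s i); last by rewrite !mul0r eqxx.
by have [<-|_] := eqVneq c (t j); last by rewrite mulr0 eqxx.
Qed.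

End Adm.

Lemma adm_mul a b c (s : 'I_a -> 'I_2) (t : 'I_b -> 'I_2) (u : 'I_c -> 'I_2) M N :
  adm s t M -> adm t u N -> adm s u (M *m N).
Proof.
move=> sM sN; apply: admP => i j; rewrite mxE ?mulr_sumr ?mulr_suml;
  apply: eq_bigr => l _; first by rewrite mulrA (admL _ _ sM).
by rewrite -mulrA (admR _ _ sN).
Qed.

Lemma adm_idm a (s : 'I_a -> 'I_2) : adm s s (idm s).
Proof.
move=> i j; rewrite mxE; case: eqP => [->|_]; first by rewrite !eidxK.
by rewrite mulr0 mul0r.
Qed.

Lemma adm_delta a b (s : 'I_a -> 'I_2) (t : 'I_b -> 'I_2) i j x :
  x = e (s i) * x * e (t j) ->
  adm s t (\matrix_(p, q) if (p == i) && (q == j) then x else 0).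
Proof.
move=> ex p q; rewrite mxE; case: andP => [[/eqP-> /eqP->] //|_].
by rewrite mulr0 mul0r.
Qed.

Lemma iso_refl T : valid T -> iso T T.
Proof.
move=> vT; exists (idm (cp T)), (idm (cq T)), (idm (cp T)), (idm (cq T)).
have ch : chain_map e1 e2 T T (idm (cp T)) (idm (cq T)).
  by split; [exact: adm_idm | split; [exact: adm_idm | rewrite (adm_idl vT) (adm_idr vT)]].
have hh : homotopic e1 e2 T T (idm (cp T) *m idm (cp T)) (idm (cp T))
                              (idm (cq T) *m idm (cq T)) (idm (cq T)).
  exists 0; split; first exact: adm0.
  by rewrite !(adm_idl (adm_idm _)) !subrr mul0mx mulmx0.
by [].
Qed.

Lemma iso_sym T T' : iso T T' -> iso T' T.
Proof. by case=> f1 [f0] [g1] [g0] [? [? []]]; exists g1, g0, f1, f0. Qed.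

Lemma chain_map_comp T T' T'' f1 f0 g1 g0 :
  chain_map e1 e2 T T' f1 f0 -> chain_map e1 e2 T' T'' g1 g0 ->
  chain_map e1 e2 T T'' (g1 *m f1) (g0 *m f0).
Proof.
case=> [af1 [af0 fd]] [ag1 [ag0 gd]].
split; first exact: adm_mul ag1 af1.
by split; [exact: adm_mul ag0 af0 | rewrite mulmxA gd -mulmxA fd mulmxA].
Qed.

(** The two homotopies combine to g1 h' f0 + h. Transitivity of [iso_K] uses this once for each
    composite. *)
Lemma homotopic_id_comp T T' f1 f0 g1 g0 u1 u0 :
  chain_map e1 e2 T T' f1 f0 -> chain_map e1 e2 T' T g1 g0 ->
  homotopic e1 e2 T T (g1 *m f1) (idm (cp T)) (g0 *m f0) (idm (cq T)) ->
  homotopic e1 e2 T' T' u1 (idm (cp T')) u0 (idm (cq T')) ->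
  homotopic e1 e2 T T (g1 *m u1 *m f1) (idm (cp T)) (g0 *m u0 *m f0) (idm (cq T)).
Proof.
case=> [af1 [af0 fd]] [ag1 [ag0 gd]] [h [ah [h1 h0]]] [h' [ah' [h1' h0']]].
exists (g1 *m h' *m f0 + h); split; last split.
- apply: admD ah; apply: adm_mul af0; exact: adm_mul ag1 ah'.
- rewrite mulmxDl -h1 -!mulmxA -fd (mulmxA h') -h1' mulmxBl mulmxBr.
  by rewrite (adm_idl af1) addrA subrK.
- rewrite mulmxDr -h0 !mulmxA gd -(mulmxA g0 (cd T')) -h0' mulmxBr mulmxBl.
  by rewrite (adm_idr ag0) addrA subrK.
Qed.

Lemma iso_trans T T' T'' : iso T T' -> iso T' T'' -> iso T T''.
Proof.
move=> [f1 [f0 [g1 [g0 [cf [cg [hT hT']]]]]]].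
move=> [f1' [f0' [g1' [g0' [cf' [cg' [hT2 hT'']]]]]]].
exists (f1' *m f1), (f0' *m f0), (g1 *m g1'), (g0 *m g0').
split; first exact: chain_map_comp cf cf'.
split; first exact: chain_map_comp cg' cg.
have := homotopic_id_comp cf cg hT hT2.
have := homotopic_id_comp cg' cf' hT'' hT'.
by rewrite !mulmxA.
Qed.

(** A map x is carried to g0' x f1, decomposed there and carried back. The result f0' g0' x f1 g1
    differs from x by homotopy terms, which the corrections by h' and h absorb. *)
Lemma hom_shift1_zero_iso T S T' S' : iso T S -> iso T' S' ->
  hom_shift1_zero e1 e2 T T' -> hom_shift1_zero e1 e2 S S'.
Proof.
move=> [f1 [f0 [g1 [g0 [[af1 [af0 fd]] [[ag1 [ag0 gd]] [_ [h [ah [h1 _]]]]]]]]]].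
move=> [f1' [f0' [g1' [g0' [[af1' [af0' fd']] [[ag1' [ag0' gd']] [_ [h' [ah' [_ h0']]]]]]]]]].
move=> TT' x ax.
have [|a [b [aa [ab gab]]]] := TT' (g0' *m x *m f1).
  by apply: adm_mul af1; apply: adm_mul ag0' ax.
exists (f1' *m a *m g1 - h' *m x *m (f1 *m g1)), (f0' *m b *m g0 - x *m h).
split.
  apply: admD; first by apply: adm_mul ag1; apply: adm_mul af1' aa.
  by apply: admN; apply: adm_mul (adm_mul ah' ax) (adm_mul af1 ag1).
split.
  apply: admD; first by apply: adm_mul ag0; apply: adm_mul af0' ab.
  by apply: admN; apply: adm_mul ax ah.
rewrite mulmxBr mulmxBl.
have -> : cd S' *m (f1' *m a *m g1) = f0' *m (cd T' *m a) *m g1.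
  by rewrite !mulmxA fd'.
have -> : f0' *m b *m g0 *m cd S = f0' *m (b *m cd T) *m g1.
  by rewrite -!mulmxA gd.
rewrite addrACA -mulmxDl -mulmxDr -gab.
have -> : cd S' *m (h' *m x *m (f1 *m g1)) = (f0' *m g0' - idm (cq S')) *m x *m (f1 *m g1).
  by rewrite h0' !mulmxA.
have -> : x *m h *m cd S = x *m (f1 *m g1 - idm (cp S)) by rewrite h1 mulmxA.
rewrite !mulmxBl mulmxBr (adm_idl ax) (adm_idr ax) !mulmxA.
by rewrite -opprD addrA subrK opprB addrC subrK.
Qed.

Lemma indec_iso T S : iso T S -> indec_K e1 e2 T -> indec_K e1 e2 S.
Proof.
move=> TS [T0 Tind]; split=> [S0|U V vU vV SUV].
  by apply: T0; apply: iso_trans TS S0.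
by apply: Tind => //; apply: iso_trans TS SUV.
Qed.

Lemma iso_zero_cx T : cm T = 0 -> cn T = 0 -> iso T (zero_cx A).
Proof.
case: T => m n p q d /= m0 n0; subst m n.
exists 0, 0, 0, 0; split; first by do ![split | exact: adm0]; rewrite mulmx0 mul0mx.
split; first by do ![split | exact: adm0]; rewrite mulmx0 mul0mx.
by split; exists 0; (split; first exact: adm0); split; apply/matrixP; case.
Qed.

(** The identity is homotopic to a map through zero, so minus the identity is h d in degree -1 and d
    h in degree 0. These have radical entries, but phi_c(e_c) = 1, so there are no diagonal
    entries. *)
Lemma minimal_zero T : minimal phi T -> iso T (zero_cx A) -> cm T = 0 /\ cn T = 0.
Proof.
move=> mT [f1 [f0 [g1 [g0 [_ [_ [[h [_ [h1 h0]]] _]]]]]]].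
split; apply/eqP; rewrite -leqn0 leqNgt; apply/negP => gt0.
  pose o := Ordinal gt0; move/matrixP/(_ o o)/(congr1 (phi (cp T o))): h1.
  rewrite (char_mulmx_eq0 (split_char sp _)) => [|l]; last by right; apply: mT.
  rewrite (thinmx0 g1) mul0mx sub0r !mxE eqxx (charN (split_char sp _)).
  by rewrite (split_phi sp) eqxx => /eqP; rewrite oppr_eq0 oner_eq0.
pose o := Ordinal gt0; move/matrixP/(_ o o)/(congr1 (phi (cq T o))): h0.
rewrite (char_mulmx_eq0 (split_char sp _)) => [|l]; last by left; apply: mT.
rewrite (thinmx0 g0) mul0mx sub0r !mxE eqxx (charN (split_char sp _)).
by rewrite (split_phi sp) eqxx => /eqP; rewrite oppr_eq0 oner_eq0.
Qed.

(** If e_c A occurred in both places, the matrix with single entry e_c would have the form d' a + b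
    d. Radical differentials put this sum in the kernel of phi_c, whereas phi_c(e_c) = 1. *)
Lemma minimal_sign T T' i j : minimal phi T -> minimal phi T' ->
  hom_shift1_zero e1 e2 T T' -> cq T' i != cp T j.
Proof.
move=> mT mT' TT'; apply/eqP=> ij; set c := cp T j in ij.
have [|a [b [_ [_ /matrixP/(_ i j)/(congr1 (phi c))]]]] :=
  TT' (\matrix_(p, q) if (p == i) && (q == j) then e c else 0).
  by apply: adm_delta; rewrite ij !eidxK.
rewrite mxE !eqxx (split_phi sp) eqxx mxE (charD (split_char sp c)).
rewrite !(char_mulmx_eq0 (split_char sp c)).
- by rewrite addr0 => /eqP; rewrite oner_eq0.
- by move=> l; right; apply: mT.
- by move=> l; left; apply: mT'.
Qed.

(** The corner e_c A e_c is local with residue map phi_c. For a = 1 / phi_c(u), all characters kill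
    e_c - a u, so 1 - (e_c - a u) has an inverse z, and a e_c z e_c inverts u in the corner. *)
Lemma local_unit c u : u = e c * u * e c -> phi c u != 0 ->
  exists v, [/\ v = e c * v * e c, u * v = e c & v * u = e c].
Proof.
move=> eu nz; pose a := (phi c u)^-1.
have [|z [zr zl]] := split_rad sp (x := e c - a *: u).
  move=> d; rewrite (charB (split_char sp d)) (charZ (split_char sp d)) (split_phi sp).
  have [->|dc] := eqVneq; first by rewrite mulVf ?subrr.
  by rewrite eu !(charM (split_char sp d)) (split_phi sp) (negPf dc) !mul0r mulr0 subrr.
have uL : e c * u = u by rewrite eu !mulrA eidxK.
have uR : u * e c = u by rewrite eu -!mulrA eidxK.
have eL : e c * (1 - (e c - a *: u)) = a *: u.
  by rewrite mulrBr mulrBr mulr1 eidxK -scalerAr uL opprB addrC subrK.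
have eR : (1 - (e c - a *: u)) * e c = a *: u.
  by rewrite mulrBl mulrBl mul1r eidxK -scalerAl uR opprB addrC subrK.
exists (a *: (e c * z * e c)); split.
- by rewrite -scalerAr -scalerAl eidx_mulm.
- rewrite -scalerAr scalerAl !mulrA.
  have -> : a *: u * e c = a *: u by rewrite -scalerAl uR.
  by rewrite -eL -(mulrA (e c)) zr mulr1 eidxK.
- rewrite -scalerAl scalerAr -!mulrA.
  have -> : e c * (a *: u) = a *: u by rewrite -scalerAr uL.
  by rewrite -eR (mulrA z) zl mul1r eidxK.
Qed.

End HomotopyCategory.

(** * Minimal complexes *)

Lemma mul_col'_row' (S : pzSemiRingType) a b c (M : 'M[S]_(a, b.+1))
    (N : 'M[S]_(b.+1, c)) j :
  (forall x, M x j = 0) \/ (forall y, N j y = 0) ->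
  col' j M *m row' j N = M *m N.
Proof.
move=> MN0; apply/matrixP=> x y; rewrite !mxE (bigD1_ord j) //=.
have -> : M x j * N j y = 0 by case: MN0 => ->; rewrite ?mul0r ?mulr0.
by rewrite add0r; apply: eq_bigr => l _; rewrite !mxE.
Qed.

Definition mult {a : nat} (s : 'I_a -> 'I_2) (c : 'I_2) : nat :=
  #|[pred j | s j == c]|.

Lemma mult_lift a (s : 'I_a.+1 -> 'I_2) i c :
  mult s c = ((s i == c) + mult (s \o lift i) c)%N.
Proof.
rewrite /mult -!sum1_card big_mkcond (bigD1_ord i) //= [in RHS]big_mkcond.
by rewrite /= /in_mem /=; case: (s i == c).
Qed.

Section MinimalForm.
Context {k : fieldType} {A : falgType k} {e1 e2 : A} {phi : 'I_2 -> A -> k}.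
Hypothesis sp : split_idem e1 e2 phi.
Notation e := (eidx e1 e2).
Notation adm := (adm e1 e2).
Notation idm := (idm e1 e2).
Notation iso := (iso_K e1 e2).
Notation valid := (valid_cx e1 e2).

Lemma adm_row' a b (s : 'I_a.+1 -> 'I_2) (t : 'I_b -> 'I_2) M i :
  adm s t M -> adm (s \o lift i) t (row' i M).
Proof. by move=> sM x y; rewrite mxE; exact: sM. Qed.

Lemma adm_col' a b (s : 'I_a -> 'I_2) (t : 'I_b.+1 -> 'I_2) M j :
  adm s t M -> adm s (t \o lift j) (col' j M).
Proof. by move=> sM x y; rewrite mxE; exact: sM. Qed.

(* Cancelling a contractible summand e_c A -> e_c A.  With h = -v at (j, i), the
   endomorphisms E1 = 1 + h d and E0 = 1 + d h are homotopic to the identity and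
   kill the j-th and the i-th coordinate respectively. *)
Lemma iso_cancel m n (p : 'I_m.+1 -> 'I_2) (q : 'I_n.+1 -> 'I_2) d i j v :
  adm q p d -> q i = p j -> v = e (p j) * v * e (p j) ->
  d i j * v = e (p j) -> v * d i j = e (p j) ->
  exists d', adm (q \o lift i) (p \o lift j) d' /\
    iso (@Cx A m.+1 n.+1 p q d) (@Cx A m n (p \o lift j) (q \o lift i) d').
Proof.
move=> ad qp ev dv vd.
pose h : 'M_(m.+1, n.+1) := \matrix_(x, y) if (x == j) && (y == i) then - v else 0.
have ah : adm p q h by apply: adm_delta; rewrite qp mulrN mulNr -ev.
pose E1 := idm p + h *m d; pose E0 := idm q + d *m h.
have hdE x y : (h *m d) x y = if x == j then - v * d i y else 0.
  rewrite mxE (bigD1 i) //= big1 => [|l /negPf li]; rewrite mxE.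
    by rewrite eqxx andbT addr0; case: eqP => _; rewrite ?mul0r.
  by rewrite li andbF mul0r.
have dhE x y : (d *m h) x y = if y == i then - (d x j * v) else 0.
  rewrite mxE (bigD1 j) //= big1 => [|l /negPf lj]; rewrite mxE.
    by rewrite eqxx addr0 /=; case: eqP => _; rewrite ?mulr0 ?mulrN.
  by rewrite lj mulr0.
have aE1 : adm p p E1 by apply: admD; [exact: (adm_idm sp) | exact: (adm_mul sp ah ad)].
have aE0 : adm q q E0 by apply: admD; [exact: (adm_idm sp) | exact: (adm_mul sp ad ah)].
have E1j x : E1 x j = 0.
  rewrite mxE hdE mxE; case: eqP => [->|_]; last by rewrite addr0.
  by rewrite mulNr vd subrr.
have E0i y : E0 i y = 0.
  rewrite mxE dhE mxE eq_sym; case: eqP => _; last by rewrite addr0.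
  by rewrite dv qp subrr.
(* Being both [E0 *m d] and [d *m E1], the matrix [D] vanishes in row i and column j, so deleting
   them loses nothing. *)
pose D := E0 *m d.
have DE : D = d *m E1.
  by rewrite /D /E0 /E1 mulmxDl mulmxDr (adm_idl sp ad) (adm_idr sp ad) mulmxA.
have Di y : D i y = 0 by rewrite mxE big1 // => l _; rewrite E0i mul0r.
have Dj x : D x j = 0 by rewrite DE mxE big1 // => l _; rewrite E1j mulr0.
have aD : adm q p D by apply: (adm_mul sp aE0 ad).
exists (row' i (col' j D)).
split; first by apply: adm_row'; apply: adm_col'.
(* Forward: projection, preceded by [E0] in degree 0. Backward: inclusion, followed by [E1] in
   degree -1. The composites are [E1], [E0] on the source, homotopic to 1 through [h], and exactly 1
   on the target. *)
exists (row' j (idm p)), (row' i E0), (col' j E1), (col' i (idm q)).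
have row'M a b c (M : 'M[A]_(a.+1, b)) (N : 'M_(b, c)) x : row' x M *m N = row' x (M *m N).
  by apply/matrixP=> y z; rewrite !mxE; apply: eq_bigr => l _; rewrite !mxE.
have col'M a b c (M : 'M[A]_(a, b)) (N : 'M_(b, c.+1)) x : M *m col' x N = col' x (M *m N).
  by apply/matrixP=> y z; rewrite !mxE; apply: eq_bigr => l _; rewrite !mxE.
have aidp := adm_idm sp p; have aidq := adm_idm sp q.
split; [|split; [|split]].
- split; first exact: adm_row'.
  split; first exact: adm_row'.
  rewrite /= !row'M mul_col'_row' ?(adm_idr sp aD) //; by left.
- split; first exact: adm_col'.
  split; first exact: adm_col'.
  rewrite /= !col'M -DE mul_col'_row'; first by rewrite col'M (adm_idl sp aD).
  by right=> y; rewrite mxE.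
- exists h; split => //=.
  rewrite !mul_col'_row'; [|by right|by left].
  by rewrite (adm_idr sp aE1) (adm_idl sp aE0) /E1 /E0 ![idm _ + _]addrC !addrK.
- exists 0; split; first exact: adm0.
  rewrite mul0mx mulmx0 /= !row'M !col'M (adm_idl sp aE1) (adm_idr sp aE0).
  have lift_idm a (s : 'I_a.+1 -> 'I_2) x y z :
      idm s (lift x y) (lift x z) = idm (s \o lift x) y z.
    by rewrite !mxE (inj_eq (lift_inj (h := x))).
  have row'_col' a (M : 'M[A]_a.+1) x y z :
      row' x (col' x M) y z = M (lift x y) (lift x z) by rewrite 2!mxE.
  split; apply/eqP; rewrite subr_eq0; apply/eqP/matrixP=> x y.
    by rewrite row'_col' /E1 mxE lift_idm hdE lift_eqF addr0.
  by rewrite row'_col' /E0 mxE lift_idm dhE lift_eqF addr0.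
Qed.

(** Cancel non-radical entries one at a time, by induction on the number of summands in degree -1.
    The last clause is equality of g-vectors, written without subtraction in the natural numbers. *)
Lemma minimal_form T : valid T -> exists T',
  [/\ valid T', minimal phi T', iso T T' &
      forall c, (mult (cq T) c + mult (cp T') c = mult (cq T') c + mult (cp T) c)%N].
Proof.
have [N leN] := ubnP (cm T); elim: N T leN => // N IHN T leN vT.
have [|] := boolP [exists c, [exists i, exists j, phi c (cd T i j) != 0]]; last first.
  move=> noT; exists T; split => //; last exact: (iso_refl sp vT).
  move=> c i j; apply: contraNeq noT => nz.
  by apply/existsP; exists c; apply/existsP; exists i; apply/existsP; exists j.
case/existsP=> c0 /existsP[i /existsP[j nz]].
case: T leN vT i j nz => [[|m] [|n] p q d] //= leN vT i j; try by case: i; try by case: j.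
move=> nz; have [qp pj] := adm_phi_neq0 sp vT nz; rewrite -{}pj /= in qp nz.
have [|//|v [ev dv vd]] := local_unit sp (c := p j) (u := d i j).
  by rewrite [LHS]vT /= qp.
have [d' [vd' isod']] := iso_cancel vT qp ev dv vd.
have [T' [vT' mT' iT' multT']] := IHN (@Cx A m n (p \o lift j) (q \o lift i) d') leN vd'.
exists T'; split=> //; first exact: (iso_trans sp isod' iT').
move=> c; rewrite /= (mult_lift q i) (mult_lift p j) qp.
by rewrite -addnA multT' /= addnCA.
Qed.

End MinimalForm.

(** * Presilting families and base change *)

(** The conditions that [gfan] puts on a family, separated from the cone. *)
Definition presilting {k : fieldType} {A : falgType k} (e1 e2 : A) {r : nat}
    (T : 'I_r -> cx A) : Prop :=
  (forall i, valid_cx e1 e2 (T i) /\ indec_K e1 e2 (T i)) /\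
  (forall i j, i != j -> ~ iso_K e1 e2 (T i) (T j)) /\
  (forall i j, hom_shift1_zero e1 e2 (T i) (T j)).

(** For a valid complex the differential then has its entries in e_c A e_(oidx c). *)
Definition opposite {A : Type} (c : 'I_2) (T : cx A) : Prop :=
  (forall x, cp T x = oidx c) /\ (forall x, cq T x = c).

(* The g-vectors then lie in one of the three closed quadrants other than the
   one spanned by -[e_c A] and [e_(oidx c) A]. *)
Definition oriented {A : Type} (c : 'I_2) {r : nat} (T : 'I_r -> cx A) : Prop :=
  [\/ forall i, cm (T i) = 0, forall i, cn (T i) = 0 |
      forall i, opposite c (T i)].

Section Families.
Context {k : fieldType} {A : falgType k} {e1 e2 : A} {phi : 'I_2 -> A -> k}.
Hypothesis sp : split_idem e1 e2 phi.
Notation e := (eidx e1 e2).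
Notation adm := (adm e1 e2).
Notation idm := (idm e1 e2).
Notation iso := (iso_K e1 e2).
Notation valid := (valid_cx e1 e2).

Lemma presilting_minimal r (T : 'I_r -> cx A) : presilting e1 e2 T ->
  exists T' : 'I_r -> cx A, [/\ presilting e1 e2 T', forall i, minimal phi (T' i) &
    forall R : realType, (fun i => gvec (R := R) (T' i)) = (fun i => gvec (T i))].
Proof.
move=> [vT [nT hT]].
have [T' T'P] := fin_all_exists (fun i => minimal_form sp (proj1 (vT i))).
exists T'; split; last 1 first.
- move=> R; apply/funext => i; have [_ _ _ mT] := T'P i.
  suff gE c : gcoord (T' i) c = gcoord (R := R) (T i) c by rewrite /gvec !gE.
  apply/eqP; rewrite /gcoord subr_eq addrAC eq_sym subr_eq -!natrD.
  by have := mT c; rewrite /mult => ->; rewrite addnC.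
- split; last split.
  + move=> i; have [vT' _ iT _] := T'P i; split=> //.
    exact: (indec_iso sp iT (proj2 (vT i))).
  + move=> i j ij T'ij; have [_ _ iTi _] := T'P i; have [_ _ iTj _] := T'P j.
    apply: (nT i j ij); apply: (iso_trans sp iTi _).
    exact: (iso_trans sp T'ij (iso_sym iTj)).
  + move=> i j; have [_ _ iTi _] := T'P i; have [_ _ iTj _] := T'P j.
    exact: (hom_shift1_zero_iso sp iTi iTj (hT i j)).
- by move=> i; have [] := T'P i.
Qed.

Lemma presilting_sign r (T : 'I_r -> cx A) c : presilting e1 e2 T ->
  (forall i, minimal phi (T i)) ->
  (forall i x, cp (T i) x = oidx c) \/ (forall i x, cq (T i) x = oidx c).
Proof.
move=> [_ [_ hT]] mT; apply: contrapT => /not_orP[].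
move=> /existsNP[i /existsNP[x px]] /existsNP[j /existsNP[y qy]].
have /eqP[] := minimal_sign sp y x (mT i) (mT j) (hT i j).
by transitivity c; [|symmetry]; apply: contrapT => /eqP/neq_oidx.
Qed.

(** [presilting_sign] is applied to both indices. Of the four combinations, two empty one of the
    degrees throughout the family, and two put the indecomposable projectives in opposite
    degrees. *)
Lemma presilting_oriented r (T : 'I_r -> cx A) c : presilting e1 e2 T ->
  (forall i, minimal phi (T i)) ->
  oriented c T \/ (forall i, opposite (oidx c) (T i)).
Proof.
have noI n (s : 'I_n -> 'I_2) : s =1 (fun=> c) -> s =1 (fun=> oidx c) -> n = 0.
  case: n s => // n s sc /(_ ord0); rewrite sc => /eqP.
  by rewrite eq_sym (negPf (oidx_neq c)).
move=> pT mT; have := presilting_sign (oidx c) pT mT; rewrite oidxK.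
have := presilting_sign c pT mT.
case=> p1 [] p2.
- by left; constructor 1 => i; apply: noI (p2 i) (p1 i).
- by left; constructor 3.
- by right=> i; split => x; rewrite ?oidxK.
- by left; constructor 2 => i; apply: noI (p2 i) (p1 i).
Qed.

(** A complex with zero differential is the sum of its part [U] in degree 0 and its part [V] in
    degree -1. One of them is zero in the homotopy category, hence empty, as both are minimal. *)
Lemma indec_cd0 T : valid T -> cd T = 0 -> indec_K e1 e2 T ->
  cm T = 0 /\ cn T <> 0 \/ cn T = 0 /\ cm T <> 0.
Proof.
case: T => m n p q d /= vT d0; subst d => [[T0 Tind]].
have no0 : m = 0 -> n = 0 -> False by move=> m0 n0; apply: T0; apply: iso_zero_cx.
pose U := @Cx A 0 n (fun=> ord0) q 0; pose V := @Cx A m 0 p (fun=> ord0) 0.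
have idm_sum a b (s : 'I_a -> 'I_2) (t : 'I_b -> 'I_2) :
    idm (sumf s t) = block_mx (idm s) 0 0 (idm t).
  apply/matrixP=> i j; rewrite !mxE /sumf.
  case: (splitP i) => i' ii'; rewrite mxE; case: (splitP j) => j' jj'; rewrite mxE.
  + by rewrite -!val_eqE /= ii' jj'.
  + by rewrite -val_eqE /= ii' jj' ltn_eqF // (leq_trans (ltn_ord i')) ?leq_addr.
  + by rewrite -val_eqE /= ii' jj' gtn_eqF // (leq_trans (ltn_ord j')) ?leq_addr.
  + by rewrite -!val_eqE /= ii' jj' eqn_add2l.
have adm_col a b c (s : 'I_a -> 'I_2) (t : 'I_b -> 'I_2) (u : 'I_c -> 'I_2) M N :
    adm s u M -> adm t u N -> adm (sumf s t) u (col_mx M N).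
  by move=> sM tN i j; rewrite mxE /sumf; case: (splitP i).
have adm_row a b c (s : 'I_a -> 'I_2) (t : 'I_b -> 'I_2) (u : 'I_c -> 'I_2) M N :
    adm u s M -> adm u t N -> adm u (sumf s t) (row_mx M N).
  by move=> sM tN i j; rewrite mxE /sumf; case: (splitP j).
have aidp := adm_idm sp p; have aidq := adm_idm sp q.
have TUV : iso (@Cx A m n p q 0) (dsum_cx U V).
  exists (col_mx (0 : 'M_(0, m)) (idm p)), (col_mx (idm q) (0 : 'M_(0, n))).
  exists (row_mx (0 : 'M_(m, 0)) (idm p)), (row_mx (idm q) (0 : 'M_(n, 0))).
  rewrite /chain_map /homotopic /= block_mx0 !(mul0mx, mulmx0).
  do 2![split; first by do ?[split | apply: adm_col | apply: adm_row | exact: adm0]].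
  split; exists 0; (split; first exact: adm0); rewrite !(mul0mx, mulmx0).
    by rewrite !mul_row_col !(mul0mx, addr0, add0r) (adm_idl sp aidp) (adm_idl sp aidq) !subrr.
  rewrite !mul_col_row !idm_sum !(mul0mx, mulmx0) (adm_idl sp aidp) (adm_idl sp aidq).
  have z0 (M N : 'M[A]_0) : M = N by rewrite (flatmx0 M) (flatmx0 N).
  by split; rewrite (z0 (idm _) 0) subrr.
have mU : minimal phi U by move=> c i [].
have mV : minimal phi V by move=> c [].
have [||U0|V0] := Tind U V _ _ TUV.
- exact: adm0.
- exact: adm0.
- by have [_ /= n0] := minimal_zero sp mU U0; right; split=> // m0; apply: no0.
- by have [/= m0 _] := minimal_zero sp mV V0; left; split=> // n0; apply: no0.
Qed.

End Families.

(** * Base change along a ring homomorphism *)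

Definition map_cx {A B : Type} (F : A -> B) (T : cx A) : cx B :=
  @Cx B (cm T) (cn T) (cp T) (cq T) (map_mx F (cd T)).

Section Functor.
Context {k : fieldType} {A B : falgType k} {e1 e2 : A} {d1 d2 : B}.
Context {F : {rmorphism A -> B}}.
Hypothesis Fe : forall c, F (eidx e1 e2 c) = eidx d1 d2 c.

Lemma adm_map a b (s : 'I_a -> 'I_2) (t : 'I_b -> 'I_2) M :
  adm e1 e2 s t M -> adm d1 d2 s t (map_mx F M).
Proof. by move=> sM i j; rewrite mxE -!Fe -!rmorphM -sM. Qed.

Lemma map_idm a (s : 'I_a -> 'I_2) : map_mx F (idm e1 e2 s) = idm d1 d2 s.
Proof. by apply/matrixP=> i j; rewrite !mxE -Fe; case: ifP; rewrite ?rmorph0. Qed.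

Lemma chain_map_map T T' f1 f0 : chain_map e1 e2 T T' f1 f0 ->
  chain_map d1 d2 (map_cx F T) (map_cx F T') (map_mx F f1) (map_mx F f0).
Proof.
case=> [af1 [af0 fd]]; split; first exact: adm_map.
by split; [exact: adm_map | rewrite /= -!map_mxM fd].
Qed.

Lemma homotopic_map T T' f1 g1 f0 g0 : homotopic e1 e2 T T' f1 g1 f0 g0 ->
  homotopic d1 d2 (map_cx F T) (map_cx F T') (map_mx F f1) (map_mx F g1)
    (map_mx F f0) (map_mx F g0).
Proof.
case=> h [ah [h1 h0]]; exists (map_mx F h); split; first exact: adm_map.
by rewrite /= -!map_mxB -!map_mxM h1 h0.
Qed.

Lemma iso_map T T' : iso_K e1 e2 T T' -> iso_K d1 d2 (map_cx F T) (map_cx F T').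
Proof.
case=> f1 [f0] [g1] [g0] [cf [cg [hf hg]]].
exists (map_mx F f1), (map_mx F f0), (map_mx F g1), (map_mx F g0).
do 2![split; first exact: chain_map_map].
by move: (homotopic_map hf) (homotopic_map hg); rewrite !map_mxM !map_idm.
Qed.

Lemma map_dsum T T' : map_cx F (dsum_cx T T') = dsum_cx (map_cx F T) (map_cx F T').
Proof. by rewrite /map_cx /dsum_cx /= map_block_mx !map_mx0. Qed.

Lemma map_zero_cx : map_cx F (zero_cx A) = zero_cx B.
Proof. by rewrite /map_cx /zero_cx /= map_mx0. Qed.

End Functor.

(** * Transport of presilting families along a retraction *)

Section Retract.
Context {k : fieldType} {A B : falgType k} {e1 e2 : A} {d1 d2 : B}.
Context {phi : 'I_2 -> A -> k} {psi : 'I_2 -> B -> k}.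
Context {F : {rmorphism A -> B}} {S : {rmorphism B -> A}}.
Hypothesis sA : split_idem e1 e2 phi.
Hypothesis sB : split_idem d1 d2 psi.
Hypothesis Fe : forall c, F (eidx e1 e2 c) = eidx d1 d2 c.
Hypothesis Sd : forall c, S (eidx d1 d2 c) = eidx e1 e2 c.
Hypothesis FS : cancel S F.
Hypothesis psiF : forall c x, psi c (F x) = phi c x.

(** Asks S F = 1 only on matrices from degree -1 to degree 0. These contain the differentials and
    represent all of Hom(T_i, T_j[1]); endomorphisms of the terms need not be fixed. *)
Definition compat r (T : 'I_r -> cx A) : Prop :=
  forall i j (g : 'M[A]_(cn (T j), cm (T i))),
    adm e1 e2 (cq (T j)) (cp (T i)) g -> map_mx S (map_mx F g) = g.

Lemma map_cx_FS (T : cx B) : map_cx F (map_cx S T) = T.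
Proof.
case: T => m n p q d; rewrite /map_cx /=; congr Cx.
by apply/matrixP=> i j; rewrite !mxE FS.
Qed.

(** Since S F fixes every member, isomorphisms and decompositions over [B] lift along [S];
    null-homotopies over [A] are pushed down by [F]. *)
Lemma presilting_descend r (T : 'I_r -> cx A) : compat T ->
  presilting e1 e2 T -> presilting d1 d2 (fun i => map_cx F (T i)).
Proof.
move=> cT [vT [nT hT]].
have SFT i : map_cx S (map_cx F (T i)) = T i.
  have := cT i i (cd (T i)) (proj1 (vT i)); rewrite /map_cx /=.
  by case: (T i) => m n p q d /= ->.
split; last split.
- move=> i; have [vTi [Ti0 Tind]] := vT i; split; first exact: (adm_map Fe).
  split=> [/(iso_map Sd)|U V vU vV /(iso_map Sd)]; rewrite SFT.
    by rewrite map_zero_cx.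
  rewrite map_dsum => /Tind[||/(iso_map Fe)|/(iso_map Fe)];
    try exact: (adm_map Sd); rewrite map_cx_FS map_zero_cx; by [left | right].
- by move=> i j ij /(iso_map Sd); rewrite !SFT; apply: nT.
- move=> i j g /= ag.
  have [a [b [aa [ab gab]]]] := hT i j (map_mx S g) (adm_map Sd ag).
  exists (map_mx F a), (map_mx F b); split; first exact: (adm_map Fe).
  split; first exact: (adm_map Fe).
  rewrite -!map_mxM -map_mxD -gab.
  by apply/matrixP=> x y; rewrite !mxE; apply: esym; apply: FS.
Qed.

Lemma presilting_ascend r (T : 'I_r -> cx B) : compat (fun i => map_cx S (T i)) ->
  presilting d1 d2 T -> presilting e1 e2 (fun i => map_cx S (T i)).
Proof.
move=> cT [vT [nT hT]].
(* [F] preserves minimality, because the characters of [A] factor through it. So a minimal form with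
   zero image is already empty. This is what lets indecomposability be tested over [B]. *)
have F_reflects0 U : valid_cx e1 e2 U ->
    iso_K d1 d2 (map_cx F U) (zero_cx B) -> iso_K e1 e2 U (zero_cx A).
  move=> vU FU0; have [U' [vU' mU' UU' _]] := minimal_form sA vU.
  have mFU' : minimal psi (map_cx F U') by move=> c i j; rewrite mxE psiF; apply: mU'.
  have [|m0 n0] := minimal_zero sB mFU'.
    exact: (iso_trans sB (iso_sym (iso_map Fe UU')) FU0).
  by apply: (iso_trans sA UU' _); apply: iso_zero_cx.
split; last split.
- move=> i; have [vTi [Ti0 Tind]] := vT i; split; first exact: (adm_map Sd).
  split=> [/(iso_map Fe)|U V vU vV /(iso_map Fe)]; rewrite map_cx_FS.
    by rewrite map_zero_cx.
  rewrite map_dsum => /Tind[||U0|V0]; try exact: (adm_map Fe).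
    by left; apply: F_reflects0.
  by right; apply: F_reflects0.
- by move=> i j ij /(iso_map Fe); rewrite !map_cx_FS; apply: nT.
- move=> i j g /= ag.
  have [a [b [aa [ab gab]]]] := hT i j (map_mx F g) (adm_map Fe ag).
  exists (map_mx S a), (map_mx S b); split; first exact: (adm_map Sd).
  split; first exact: (adm_map Sd).
  by rewrite -!map_mxM -map_mxD -gab (cT i j).
Qed.

(** The matrices concerned are empty in the first two cases of [oriented], and in the third their
    entries lie in e_c A e_(oidx c). *)
Lemma oriented_compat c r (T : 'I_r -> cx A) :
  (forall x, S (F (eidx e1 e2 c * x * eidx e1 e2 (oidx c))) =
             eidx e1 e2 c * x * eidx e1 e2 (oidx c)) ->
  oriented c T -> compat T.
Proof.
move=> SFc oT i j g ag; apply/matrixP=> x y.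
case: oT => [m0|n0|opp]; first by have := ltn_ord y; rewrite [X in (_ < X)%N](m0 i).
  by have := ltn_ord x; rewrite [X in (_ < X)%N](n0 j).
by rewrite !mxE (ag x y) (proj1 (opp i)) (proj2 (opp j)).
Qed.

End Retract.

(** * Cones *)

Section Cones.
Context {R : realType}.
Implicit Types (v w : R * R) (c : 'I_2).

Definition coord2 v c : R := if c == ord0 then v.1 else v.2.

Lemma coord2_inj v w : coord2 v =1 coord2 w -> v = w.
Proof.
by move: v w => [v1 v2] [w1 w2] vw; congr pair; [apply: vw ord0 | apply: vw ord_max].
Qed.

Lemma coord2_gvec A (T : cx A) c : coord2 (gvec T) c = gcoord T c.
Proof. by move: c; apply: I2P. Qed.

Lemma coneP r (g : 'I_r -> R * R) v : cone g v <->
  exists l : 'I_r -> R, (forall i, 0 <= l i) /\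
    forall c, coord2 v c = \sum_i l i * coord2 (g i) c.
Proof.
split=> -[l [l0 vE]]; exists l; split=> //.
  by rewrite vE; apply: I2P.
by apply: coord2_inj; apply: I2P; rewrite vE.
Qed.

(** Indexing by [c] treats sigma_-+ ([ord0]) and sigma_+- ([ord_max]) together. *)
Definition quadrant c v : Prop := coord2 v c <= 0 /\ 0 <= coord2 v (oidx c).

Definition unit2 c (x : R) : R * R := if c == ord0 then (x, 0) else (0, x).

Lemma coord2_unit2 c d x : coord2 (unit2 c x) d = if c == d then x else 0.
Proof. by move: c d; do 2!apply: I2P. Qed.

Lemma cone_quadrant c (g : 'I_2 -> R * R) :
  g c = unit2 c (-1) -> g (oidx c) = unit2 (oidx c) 1 -> cone g = quadrant c.
Proof.
move=> gc gc'; have sumE (l : 'I_2 -> R) d : \sum_i l i * coord2 (g i) d =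
    l c * coord2 (g c) d + l (oidx c) * coord2 (g (oidx c)) d.
  rewrite big_ord_recl big_ord1 (_ : lift _ _ = ord_max); last exact: val_inj.
  by move: c {gc gc'}; apply: I2P => //; rewrite addrC.
have [cF c'F] : (c == oidx c) = false /\ (oidx c == c) = false.
  by rewrite eq_sym; have /negPf-> := oidx_neq c.
apply/funext => v; apply/propext; rewrite coneP; split=> [[l [l0 vE]]|[vc vc']].
  rewrite /quadrant !vE !sumE gc gc' !coord2_unit2 !eqxx cF c'F.
  by rewrite !mulr0 addr0 add0r mulr1 mulrN1 oppr_le0 !l0.
exists (fun d => if d == c then - coord2 v c else coord2 v (oidx c)).
split=> [i|d]; first by case: ifP; rewrite ?oppr_ge0.
rewrite sumE gc gc' !coord2_unit2 eqxx c'F; have [->|/neq_oidx->] := eqVneq d c.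
  by rewrite ?eqxx ?c'F mulr0 addr0 mulrN1 opprK.
by rewrite ?cF ?eqxx mulr0 add0r mulr1.
Qed.

Lemma sigma_mpE : sigma_mp R = quadrant ord0.
Proof. exact: cone_quadrant. Qed.

Lemma sigma_pmE : sigma_pm R = quadrant ord_max.
Proof. exact: cone_quadrant. Qed.

Lemma quadrant_unit2 c : quadrant c (unit2 c (-1)) /\ quadrant c (unit2 (oidx c) 1).
Proof.
by move: c; apply: I2P; rewrite /quadrant !coord2_unit2 /= lerN10 ler01 lexx.
Qed.

Lemma quadrant_dim c : dim_eq2 (quadrant c).
Proof.
move=> [w dw]; have [/dw[s vs] /dw[t vt]] := quadrant_unit2 c.
have coordZ x d : coord2 (x * w.1, x * w.2) d = x * coord2 w d.
  by move: d; apply: I2P.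
have := congr1 (coord2^~ c) vs; have := congr1 (coord2^~ (oidx c)) vs.
have := congr1 (coord2^~ (oidx c)) vt.
rewrite /= !coordZ !coord2_unit2 !eqxx eq_sym (negPf (oidx_neq c)).
move=> t1 /esym/eqP; rewrite mulf_eq0 => /orP[/eqP->|/eqP w0].
  by rewrite mul0r => /eqP; rewrite oppr_eq0 oner_eq0.
by move/eqP: t1; rewrite w0 mulr0 oner_eq0.
Qed.

Lemma mult_neq a (s : 'I_a -> 'I_2) c : (forall x, s x != c) -> mult s c = 0.
Proof. by move=> sc; apply: eq_card0 => x; rewrite inE (negPf (sc x)). Qed.

Lemma mult_const a (s : 'I_a -> 'I_2) c : (forall x, s x = c) -> mult s c = a.
Proof. by move=> sc; rewrite -[RHS]card_ord; apply: eq_card => x; rewrite !inE sc eqxx. Qed.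

Lemma gcoordE A (T : cx A) c : gcoord T c = (mult (cq T) c)%:R - (mult (cp T) c)%:R :> R.
Proof. by []. Qed.

Lemma mult0 a (s : 'I_a -> 'I_2) c : a = 0 -> mult s c = 0.
Proof. by move=> a0; subst a; apply: eq_card0 => -[]. Qed.

Lemma cone_ge0 r (g : 'I_r -> R * R) c v :
  (forall i, 0 <= coord2 (g i) c) -> cone g v -> 0 <= coord2 v c.
Proof.
by move=> g0 /coneP[l [l0 ->]]; apply: sumr_ge0 => i _; rewrite mulr_ge0.
Qed.

Lemma cone_le0 r (g : 'I_r -> R * R) c v :
  (forall i, coord2 (g i) c <= 0) -> cone g v -> coord2 v c <= 0.
Proof.
by move=> g0 /coneP[l [l0 ->]]; apply: sumr_le0 => i _; rewrite mulr_ge0_le0.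
Qed.

(** All g-vectors lie in a closed half-plane, coordinate c nonnegative or coordinate [oidx c]
    nonpositive, that misses an edge vector of the quadrant. *)
Lemma oriented_cone A c r (T : 'I_r -> cx A) : oriented c T ->
  cone (fun i => gvec (T i)) <> quadrant c.
Proof.
move=> oT; have [] := quadrant_unit2 c => uc uc' qc; rewrite -{}qc in uc uc'.
have [cpos|cneg] : (forall i, 0 <= coord2 (gvec (R := R) (T i)) c) \/
                   (forall i, coord2 (gvec (R := R) (T i)) (oidx c) <= 0).
  case: oT => [m0|n0|opp]; [left|right|left] => i; rewrite coord2_gvec gcoordE.
  - by rewrite (mult0 (cp _)) ?m0 // subr0 ler0n.
  - by rewrite (mult0 (cq _)) ?n0 // sub0r oppr_le0 ler0n.
  - rewrite (mult_neq (s := cp _)) ?subr0 ?ler0n // => x.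
    by rewrite (proj1 (opp i)) oidx_neq.
- have := cone_ge0 cpos uc; rewrite coord2_unit2 eqxx.
  by rewrite leNgt ltrN10.
- have := cone_le0 cneg uc'; rewrite coord2_unit2 eqxx.
  by rewrite leNgt ltr01.
Qed.

(** Every g-vector is a positive multiple of an edge vector of the quadrant. Not being [oriented]
    forces both edges to occur. *)
Lemma opposite_stalks_cone A c r (T : 'I_r -> cx A) :
  (forall i, opposite (oidx c) (T i)) ->
  (forall i, cm (T i) = 0 /\ cn (T i) <> 0 \/ cn (T i) = 0 /\ cm (T i) <> 0) ->
  ~ oriented c T -> cone (fun i => gvec (T i)) = quadrant c.
Proof.
move=> opp stalk noT.
have cpE i x : cp (T i) x = c by rewrite (proj1 (opp i)) oidxK.
have cqE i x : cq (T i) x = oidx c by rewrite (proj2 (opp i)).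
have gc i : gcoord (T i) c = - (cm (T i))%:R :> R.
  rewrite gcoordE (mult_const (cpE i)) mult_neq ?sub0r // => x.
  by rewrite cqE oidx_neq.
have gc' i : gcoord (T i) (oidx c) = (cn (T i))%:R :> R.
  rewrite gcoordE (mult_const (cqE i)) mult_neq ?subr0 // => x.
  by rewrite cpE eq_sym oidx_neq.
have [i mi] : exists i, cm (T i) <> 0.
  by apply: contrapT => /forallNP m0; apply: noT; constructor 1 => i; exact: contrapT (m0 i).
have [j nj] : exists j, cn (T j) <> 0.
  by apply: contrapT => /forallNP n0; apply: noT; constructor 2 => j; exact: contrapT (n0 j).
have ni : cn (T i) = 0 by case: (stalk i) => [] [].
have mj : cm (T j) = 0 by case: (stalk j) => [] [].
have ij : j != i by apply/eqP => ji; apply: nj; rewrite ji.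
apply/funext => v; apply/propext; split=> [Cv|[vc vc']].
  split; [apply: cone_le0 Cv | apply: cone_ge0 Cv] => l; rewrite coord2_gvec.
    by rewrite gc oppr_le0 ler0n.
  by rewrite gc' ler0n.
(* One member on each edge suffices; the divisions account for the number of summands in each
   stalk. *)
apply/coneP; exists (fun l => if l == i then - coord2 v c / (cm (T i))%:R else
  if l == j then coord2 v (oidx c) / (cn (T j))%:R else 0).
split=> [l|d].
  case: eqP => _; first by rewrite divr_ge0 ?oppr_ge0 ?ler0n.
  by case: eqP => _ //; rewrite divr_ge0 ?ler0n.
rewrite (bigD1 i) //= (bigD1 j) //= big1 => [|l /andP[/negPf-> /negPf->]]; last by rewrite mul0r.
rewrite !eqxx (negPf ij) addr0 !coord2_gvec.
have [->|/neq_oidx->] := eqVneq d c.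
  by rewrite !gc mj oppr0 mulr0 addr0 mulrN divfK ?opprK // pnatr_eq0; apply/eqP.
by rewrite !gc' ni mulr0 add0r divfK // pnatr_eq0; apply/eqP.
Qed.

End Cones.

(** * Comparison of g-fans along a retraction *)

Section RetractFan.
Context {k : fieldType} {A B : falgType k} {e1 e2 : A} {d1 d2 : B}.
Context {phi : 'I_2 -> A -> k} {psi : 'I_2 -> B -> k}.
Context {F : {rmorphism A -> B}} {S : {rmorphism B -> A}}.
Hypothesis sA : split_idem e1 e2 phi.
Hypothesis sB : split_idem d1 d2 psi.
Hypothesis Fe : forall c, F (eidx e1 e2 c) = eidx d1 d2 c.
Hypothesis Sd : forall c, S (eidx d1 d2 c) = eidx e1 e2 c.
Hypothesis FS : cancel S F.
Hypothesis psiF : forall c x, psi c (F x) = phi c x.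
Context {c : 'I_2}.
Hypothesis SFc : forall x, S (F (eidx e1 e2 c * x * eidx e1 e2 (oidx c))) =
                           eidx e1 e2 c * x * eidx e1 e2 (oidx c).

Lemma gfan_descend (R : realType) r (T : 'I_r -> cx A) :
  presilting e1 e2 T -> oriented c T ->
  gfan R d1 d2 (cone (fun i => gvec (T i))) /\
  cone (fun i => gvec (R := R) (T i)) <> quadrant c.
Proof.
move=> pT oT; split; last exact: oriented_cone.
have [vT [nT hT]] := presilting_descend Fe Sd FS (oriented_compat SFc oT) pT.
by exists r, (fun i => map_cx F (T i)).
Qed.

(** An oriented minimal family lifts along [S]. Otherwise the differentials lie in d_(oidx c) B d_c
    = 0, so all members are stalks and the cone is the excluded quadrant. *)
Lemma gfan_ascend (R : realType) C :
  (forall x, eidx d1 d2 (oidx c) * x * eidx d1 d2 c = 0) ->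
  gfan R d1 d2 C -> C <> quadrant c -> gfan R e1 e2 C.
Proof.
move=> B0 [r [T [vT [nT [hT ->]]]]].
have [//|U [pU mU <-]] := presilting_minimal sB (T := T).
move=> Cq; have oU : oriented c U.
  have [//|opp] := presilting_oriented sB c pU mU.
  apply: contrapT => noU; apply: Cq; apply: (opposite_stalks_cone opp _ noU) => i.
  have [vUi iUi] := proj1 pU i; apply: (indec_cd0 sB vUi _ iUi).
  apply/matrixP=> x y; rewrite vUi (proj1 (opp i)) (proj2 (opp i)) oidxK.
  by rewrite B0 mxE.
have cSU : compat (e1 := e1) (e2 := e2) (F := F) (S := S) (fun i => map_cx S (U i)).
  exact: (oriented_compat SFc (T := fun i => map_cx S (U i)) oU).
have [vSU [nSU hSU]] := presilting_ascend sA sB Fe Sd FS psiF cSU pU.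
by exists r, (fun i => map_cx S (U i)).
Qed.

End RetractFan.

(** * The fibre product *)

Lemma jacobson_idem0 (k : fieldType) (A : falgType k) (x : A) :
  Defs.idempotent x -> jacobson x -> x = 0.
Proof.
move=> xx /(_ 1)[z [z1 _]]; rewrite -[x]mulr1 -z1 mulrA mulr1 mulrBr mulr1.
by rewrite xx subrr mul0r.
Qed.

(** Each character takes the values 0 and 1 on e1 and e2 in some order. If both characters did so in
    the same order, e1 or e2 would be a radical idempotent, hence 0. So they separate e1 and e2,
    possibly after a swap. *)
Lemma elementary_split (k : fieldType) (A : falgType k) (e1 e2 : A) :
  elementary_rank2 A -> complete_prim_orth2 e1 e2 ->
  exists phi, split_idem e1 e2 phi.
Proof.
move=> [p1 [p2 [ch1 [ch2 [_ jac]]]]].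
move=> [[i1 [n1 _]] [[i2 [n2 _]] [o12 [o21 sum1]]]].
have sum p : kalg_char p -> p e1 + p e2 = 1.
  by move=> ch; rewrite -(charD ch) sum1 (char1 ch).
have build q1 q2 : kalg_char q1 -> kalg_char q2 -> q1 e1 = 1 -> q2 e1 = 0 ->
    (forall x, q1 x = 0 /\ q2 x = 0 -> jacobson x) -> exists phi, split_idem e1 e2 phi.
  move=> c1 c2 q11 q21 qjac; have q12 : q1 e2 = 0.
    by apply: (addrI 1); rewrite addr0 -[RHS](sum _ c1) q11.
  have q22 : q2 e2 = 1 by rewrite -[RHS](sum _ c2) q21 add0r.
  exists (fun c => if c == ord0 then q1 else q2); split => //.
  - by apply: I2P.
  - by do 2!apply: I2P => /=.
  - by do 2!apply: I2P => /=.
  - move=> x x0; have [z [z1 z2]] := qjac x (conj (x0 ord0) (x0 ord_max)) 1.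
    by rewrite mulr1 in z1 z2; exists z.
have phi_e2 p : kalg_char p -> p e1 = 1 -> p e2 = 0.
  by move=> ch p1e; apply: (addrI 1); rewrite addr0 -[RHS](sum _ ch) p1e.
have [p10|p11] := char_idem ch1 i1; have [p20|p21] := char_idem ch2 i1.
- by case: n1; apply: jacobson_idem0 => //; apply/jac.
- by apply: (build p2 p1) => // x [x2 x1]; apply/jac.
- by apply: (build p1 p2) => // x [x1 x2]; apply/jac.
- by case: n2; apply: jacobson_idem0 => //; apply/jac; rewrite !phi_e2.
Qed.

Section FromSplit.
Context {k : fieldType} {A : falgType k} {e1 e2 : A} {phi : 'I_2 -> A -> k}.
Hypothesis sp : split_idem e1 e2 phi.

(** Conversely, if phi_c(x) were nonzero, phi_c would kill 1 - x / phi_c(x), which then could not be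
    invertible. *)
Lemma split_jacobson x : (forall c, phi c x = 0) <-> jacobson x.
Proof.
split=> [x0 y|jx c].
  by apply: (split_rad sp) => c; rewrite (charM (split_char sp c)) x0 mul0r.
apply/eqP/negPn/negP => nz; have [z [z1 _]] := jx ((phi c x)^-1%:A).
have /eqP := congr1 (phi c) z1.
rewrite (charM (split_char sp c)) (charB (split_char sp c)) (charM (split_char sp c)).
rewrite (charZ (split_char sp c)) (char1 (split_char sp c)) mulr1 divff // subrr mul0r.
by rewrite eq_sym oner_eq0.
Qed.

Lemma split_elementary : elementary_rank2 A.
Proof.
exists (phi ord0), (phi ord_max); do 2![split; first exact: (split_char sp)].
split=> [a b|x]; last first.
  by rewrite -split_jacobson; split=> [[x0 x1]|x0 //]; apply: I2P.
exists (a *: e1 + b *: e2).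
have p c d := split_phi sp c d.
have pe c : phi c (a *: e1 + b *: e2) = a * (c == ord0)%:R + b * (c == ord_max)%:R.
  by rewrite (charD (split_char sp c)) !(charZ (split_char sp c)) -!p.
by rewrite !pe /= !mulr1 !mulr0 addr0 add0r.
Qed.

Lemma split_primitive c : primitive_idem (eidx e1 e2 c).
Proof.
have ch d := split_char sp d.
split; first by rewrite /Defs.idempotent (split_orth sp) eqxx.
split=> [e0|].
  have /eqP := split_phi sp c c; rewrite e0 (char0 (ch c)) eqxx.
  by rewrite eq_sym oner_eq0.
move=> [a [b [ia [ib [na [nb [ab [ba sab]]]]]]]].
(* The values are 0 or 1 with sum 0. The product, also 0, rules out 1 + 1 = 0 in characteristic
   2. *)
have off d : d != c -> phi d a = 0 /\ phi d b = 0.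
  move=> dc; have := split_phi sp d c; rewrite -sab (charD (ch d)) (negPf dc).
  have := congr1 (phi d) ab; rewrite (charM (ch d)) (char0 (ch d)).
  case: (char_idem (ch d) ia) => ->; case: (char_idem (ch d) ib) => -> //.
  + by rewrite add0r => _ /eqP; rewrite oner_eq0.
  + by rewrite addr0 => _ /eqP; rewrite oner_eq0.
  + by rewrite mulr1 => /eqP; rewrite oner_eq0.
have rad0 x : Defs.idempotent x -> phi c x = 0 -> (forall d, d != c -> phi d x = 0) -> x = 0.
  move=> ix xc xd; apply: jacobson_idem0 => //; apply/split_jacobson => d.
  by have [->|/xd] := eqVneq d c.
case: (char_idem (ch c) ia) => pa.
  by apply: na; apply: rad0 => // d /off[].
apply: nb; apply: rad0 => // [|d /off[] //].
by have := congr1 (phi c) ab; rewrite (charM (ch c)) pa mul1r (char0 (ch c)).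
Qed.

Lemma split_complete : complete_prim_orth2 e1 e2.
Proof.
split; first exact: split_primitive ord0.
split; first exact: split_primitive ord_max.
split; first exact: (split_orth sp ord0 ord_max).
by split; [exact: (split_orth sp ord_max ord0) | exact: (split_sum sp)].
Qed.

End FromSplit.

(** The pullback of the two maps to k x k, described by elements. It is symmetric in [L] and [L'],
    so each lemma below serves both sides. *)
Record is_fiber {k : fieldType} {L L' G : falgType k} (phi : 'I_2 -> L -> k)
    (phi' : 'I_2 -> L' -> k) (F : {rmorphism G -> L}) (F' : {rmorphism G -> L'}) :
    Prop := IsFiber {
  fiberZ : forall a x, F (a *: x) = a *: F x /\ F' (a *: x) = a *: F' x;
  fiber_inj : forall x y, F x = F y -> F' x = F' y -> x = y;
  fiber_comm : forall c x, phi c (F x) = phi' c (F' x);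
  fiber_pair : forall x x', (forall c, phi c x = phi' c x') ->
    exists y, F y = x /\ F' y = x' }.

Lemma is_fiber_sym (k : fieldType) (L L' G : falgType k) (phi : 'I_2 -> L -> k)
    (phi' : 'I_2 -> L' -> k) (F : {rmorphism G -> L}) (F' : {rmorphism G -> L'}) :
  is_fiber phi phi' F F' -> is_fiber phi' phi F' F.
Proof.
case=> fZ fi fc fp; split.
- by move=> a x; have [] := fZ a x.
- by move=> x y ? ?; apply: fi.
- by move=> c x; rewrite fc.
- by move=> x x' xx'; have [//|y [? ?]] := fp x' x; exists y.
Qed.

HB.instance Definition _ (k : fieldType) (L L' : falgType k) :=
  GRing.UnitAlgebra.on (L * L')%type.

Lemma fiber_exists (k : fieldType) (L L' : falgType k) (phi : 'I_2 -> L -> k)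
    (phi' : 'I_2 -> L' -> k) :
  (forall c, kalg_char (phi c)) -> (forall c, kalg_char (phi' c)) ->
  exists (G : falgType k) (F : {rmorphism G -> L}) (F' : {rmorphism G -> L'}),
    is_fiber phi phi' F F'.
Proof.
move=> ch ch'.
pose LL : falgType k := (L * L')%type.
(* The fibre product is realised as the kernel of this linear map, which is a subalgebra of the
   product. *)
pose d (p : LL) : 'rV[k]_2 := \row_c (phi c p.1 - phi' c p.2).
have d_lin : linear d.
  move=> a x y; apply/rowP=> c; rewrite !mxE /=.
  rewrite (charD (ch c)) (charD (ch' c)) (charZ (ch c)) (charZ (ch' c)).
  by rewrite mulrBr opprD addrACA.
pose dl : {linear LL -> 'rV[k]_2} := HB.pack d (GRing.isLinear.Build k LL 'rV[k]_2 _ d d_lin).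
pose U := lker (linfun dl).
have memU p : reflect (forall c, phi c p.1 = phi' c p.2) (p \in U).
  rewrite memv_ker lfunE /=; apply: (iffP eqP) => [/rowP p0 c|p0].
    by have := p0 c; rewrite !mxE => /eqP; rewrite subr_eq0 => /eqP.
  by apply/rowP=> c; rewrite !mxE p0 subrr.
have U1 : 1 \in U by apply/memU => c /=; rewrite (char1 (ch c)) (char1 (ch' c)).
have algU : is_aspace U.
  rewrite /is_aspace has_algid1 //=; apply/prodvP => u v /memU uU /memU vU.
  by apply/memU => c /=; rewrite (charM (ch c)) (charM (ch' c)) uU vU.
pose G : falgType k := subvs_of (ASpace algU).
(* The unit of a subalgebra is a priori only its own identity element; multiplying it by 1, which
   lies in [U], shows that it is 1. *)
have v1 : vsval (1 : G) = 1 by rewrite -[LHS]mulr1; apply: algidl.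
have vM (x y : G) : vsval (x * y) = vsval x * vsval y by [].
pose f (x : G) : L := (vsval x).1.
pose f' (x : G) : L' := (vsval x).2.
have fB : zmod_morphism f by move=> x y; rewrite /f raddfB.
have fB' : zmod_morphism f' by move=> x y; rewrite /f' raddfB.
have fM : monoid_morphism f by split; [rewrite /f v1 | move=> x y; rewrite /f vM].
have fM' : monoid_morphism f' by split; [rewrite /f' v1 | move=> x y; rewrite /f' vM].
pose F : {rmorphism G -> L} := HB.pack f (GRing.isZmodMorphism.Build G L f fB)
  (GRing.isMonoidMorphism.Build G L f fM).
pose F' : {rmorphism G -> L'} := HB.pack f' (GRing.isZmodMorphism.Build G L' f' fB')
  (GRing.isMonoidMorphism.Build G L' f' fM').
exists G, F, F'; split.
- by move=> a x; rewrite /= /f /f' linearZ.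
- move=> x y; rewrite /= /f /f' => xy1 xy2; apply: val_inj => /=.
  by move: xy1 xy2; case: (vsval x) => ? ?; case: (vsval y) => ? ? /= -> ->.
- by move=> c x; apply/memU/subvsP.
- move=> x x' xx'; have xU : (x, x') \in U by apply/memU.
  by exists (Subvs xU).
Qed.

Section Fiber.
Context {k : fieldType} {L L' G : falgType k} {e1 e2 : L} {e1' e2' : L'}.
Context {phi : 'I_2 -> L -> k} {phi' : 'I_2 -> L' -> k}.
Context {F : {rmorphism G -> L}} {F' : {rmorphism G -> L'}}.
Hypothesis fib : is_fiber phi phi' F F'.
Hypothesis sL : split_idem e1 e2 phi.
Hypothesis sL' : split_idem e1' e2' phi'.

(** The idempotents come from the pairs (e_d, e'_d). If all characters kill x, the inverses of 1 - x
    in [L] and in [L'] have all character values 1, so they glue to an inverse in [G]. *)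
Lemma fiber_split : exists f1 f2 : G,
  [/\ split_idem f1 f2 (fun c x => phi c (F x)),
      forall c, F (eidx f1 f2 c) = eidx e1 e2 c &
      forall c, F' (eidx f1 f2 c) = eidx e1' e2' c].
Proof.
have ex d : exists y, F y = eidx e1 e2 d /\ F' y = eidx e1' e2' d.
  by apply: (fiber_pair fib) => c; rewrite (split_phi sL) (split_phi sL').
have [f1 [F1 F1']] := ex ord0; have [f2 [F2 F2']] := ex ord_max.
have FE c : F (eidx f1 f2 c) = eidx e1 e2 c by move: c; apply: I2P.
have FE' c : F' (eidx f1 f2 c) = eidx e1' e2' c by move: c; apply: I2P.
exists f1, f2; split=> //; split.
- move=> c; split=> [a x y|].
    rewrite rmorphD (proj1 (fiberZ fib _ _)) (charD (split_char sL c)).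
    by rewrite (charZ (split_char sL c)).
  split=> [x y|]; first by rewrite rmorphM (charM (split_char sL c)).
  by rewrite rmorph1 (char1 (split_char sL c)).
- by move=> c d; rewrite FE (split_phi sL).
- move=> c d; apply: (fiber_inj fib); rewrite rmorphM ?FE ?FE'.
    by rewrite (split_orth sL); case: eqP; rewrite ?FE ?rmorph0.
  by rewrite (split_orth sL'); case: eqP; rewrite ?FE' ?rmorph0.
- apply: (fiber_inj fib); rewrite rmorphD rmorph1.
    by rewrite F1 F2 (split_sum sL).
  by rewrite F1' F2' (split_sum sL').
- move=> x x0; have [z [z1 z2]] := split_rad sL x0.
  have [|z' [z1' z2']] := split_rad sL' (x := F' x).
    by move=> c; rewrite -(fiber_comm fib).
  have [|y [yz yz']] := fiber_pair fib (x := z) (x' := z').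
    move=> c; have := congr1 (phi c) z1; have := congr1 (phi' c) z1'.
    rewrite !(charM (split_char sL c), charM (split_char sL' c)).
    rewrite !(charB (split_char sL c), charB (split_char sL' c)).
    rewrite !(char1 (split_char sL c), char1 (split_char sL' c)).
    by rewrite -(fiber_comm fib) x0 subr0 !mul1r => -> ->.
  exists y; split; apply: (fiber_inj fib); rewrite rmorphM rmorphB rmorph1;
    by rewrite ?yz ?yz'.
Qed.

Lemma fiber_section : exists S : {rmorphism L -> G},
  cancel S F /\ forall x, F' (S x) = phi ord0 x *: e1' + phi ord_max x *: e2'.
Proof.
pose t x := phi ord0 x *: e1' + phi ord_max x *: e2'.
have p' c d := split_phi sL' c d.
have tphi c x : phi c x = phi' c (t x).
  rewrite (charD (split_char sL' c)) !(charZ (split_char sL' c)).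
  rewrite (p' c ord0) (p' c ord_max).
  by move: c; apply: I2P => /=; rewrite !mulr1 !mulr0 ?addr0 ?add0r.
(* Preimages are chosen pointwise; they form a ring homomorphism because an element of [G] is
   determined by its two components and [t] is itself multiplicative. *)
have [s sP] := choice (fun x => fiber_pair fib (tphi^~ x)).
have Fs x : F (s x) = x by have [] := sP x.
have Fs' x : F' (s x) = t x by have [] := sP x.
have sB : zmod_morphism s.
  move=> x y; apply: (fiber_inj fib); rewrite rmorphB ?Fs // !Fs' /t.
  by rewrite !(charB (split_char sL _)) !scalerBl opprD addrACA.
have sM : monoid_morphism s.
  split=> [|x y]; apply: (fiber_inj fib); rewrite ?rmorph1 ?rmorphM ?Fs ?Fs' //.
    by rewrite /t !(char1 (split_char sL _)) !scale1r (split_sum sL').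
  rewrite /t !(charM (split_char sL _)) mulrDl !mulrDr -!scalerAl -!scalerAr.
  rewrite (split_orth sL' ord0 ord0) (split_orth sL' ord_max ord_max) /=.
  rewrite (split_orth sL' ord0 ord_max) (split_orth sL' ord_max ord0) /=.
  by rewrite !scaler0 addr0 add0r !scalerA.
exists (HB.pack s (GRing.isZmodMorphism.Build L G s sB)
  (GRing.isMonoidMorphism.Build L G s sM) : {rmorphism L -> G}).
by [].
Qed.

(** On the corner the two sides agree in [L] because [S] is a section. Both vanish in [L']: the
    right one by hypothesis, the left one because its characters factor through that zero
    component. *)
Lemma fiber_fixed (f1 f2 : G) (S : {rmorphism L -> G}) c :
  (forall c, F (eidx f1 f2 c) = eidx e1 e2 c) ->
  (forall c, F' (eidx f1 f2 c) = eidx e1' e2' c) ->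
  cancel S F -> (forall x, F' (S x) = phi ord0 x *: e1' + phi ord_max x *: e2') ->
  (forall x, eidx e1' e2' c * x * eidx e1' e2' (oidx c) = 0) ->
  (forall c, S (eidx e1 e2 c) = eidx f1 f2 c) /\
  forall x, S (F (eidx f1 f2 c * x * eidx f1 f2 (oidx c))) =
            eidx f1 f2 c * x * eidx f1 f2 (oidx c).
Proof.
move=> FE FE' FS F'S L'0; split=> [d|x]; apply: (fiber_inj fib); rewrite ?FS ?FE //.
  rewrite F'S FE' !(split_phi sL).
  by move: d; apply: I2P; rewrite /= scale1r scale0r ?addr0 ?add0r.
rewrite F'S [in RHS]rmorphM [in RHS]rmorphM !FE' L'0.
have F0 d : phi d (F (eidx f1 f2 c * x * eidx f1 f2 (oidx c))) = 0.
  by rewrite (fiber_comm fib) !rmorphM !FE' L'0 (char0 (split_char sL' d)).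
by rewrite !F0 !scale0r addr0.
Qed.

End Fiber.

(** * The g-fan of the fibre product *)

Theorem theorem4p2 (k : fieldType) (L L' : falgType k)
  (e1 e2 : L) (e1' e2' : L') :
  elementary_rank2 L -> complete_prim_orth2 e1 e2 ->
  elementary_rank2 L' -> complete_prim_orth2 e1' e2' ->
  (forall x : L, e2 * x * e1 = 0) ->
  (forall x : L', e1' * x * e2' = 0) ->
  exists (G : falgType k) (f1 f2 : G),
    elementary_rank2 G /\ complete_prim_orth2 f1 f2 /\
    forall R : realType,
      gfan R f1 f2 = fan_star (gfan R e1 e2) (gfan R e1' e2').
Proof.
move=> elL cL elL' cL' L0 L'0.
have [phi sL] := elementary_split elL cL.
have [phi' sL'] := elementary_split elL' cL'.
have [G [F [F' fib]]] := fiber_exists (split_char sL) (split_char sL').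
have [f1 [f2 [sG FE FE']]] := fiber_split fib sL sL'.
have [S [FS F'S]] := fiber_section fib sL sL'.
have [S' [FS' FS'F]] := fiber_section (is_fiber_sym fib) sL' sL.
have [Se SFc] := fiber_fixed (c := ord0) fib sL sL' FE FE' FS F'S L'0.
have [Se' SFc'] :=
  fiber_fixed (c := ord_max) (is_fiber_sym fib) sL' sL FE' FE FS' FS'F L0.
exists G, f1, f2; split; first exact: split_elementary sG.
split=> [|R]; first exact: split_complete sG.
apply/funext => C; apply/propext; split=> [[r [T [vT [nT [hT ->]]]]]|].
  have [//|U [pU mU <-]] := presilting_minimal sG (T := T).
  set D := cone _.
  (* An oriented family for [ord0] descends to [L]; the remaining kind is oriented for [ord_max] and
     descends to [L']. The dimension of the cone then only selects the clause of [fan_star]. *)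
  have [[gD Dq]|[gD Dq]] : (gfan R e1 e2 D /\ D <> sigma_mp R) \/
                           (gfan R e1' e2' D /\ D <> sigma_pm R).
    rewrite sigma_mpE sigma_pmE.
    have [oU|opp] := presilting_oriented sG ord0 pU mU.
      by left; exact: (gfan_descend FE Se FS SFc R pU oU).
    by right; apply: (gfan_descend FE' Se' FS' SFc' R pU); constructor 3.
  - by have [?|?] := pselect (dim_le1 D); [left | right; right; left].
  - by have [?|?] := pselect (dim_le1 D); [right; left | right; right; right].
have up : gfan R e1 e2 C -> C <> sigma_mp R -> gfan R f1 f2 C.
  by rewrite sigma_mpE; apply: (gfan_ascend sG sL FE Se FS _ SFc L0).
have up' : gfan R e1' e2' C -> C <> sigma_pm R -> gfan R f1 f2 C.
  rewrite sigma_pmE; apply: (gfan_ascend sG sL' FE' Se' FS' _ SFc' L'0) => c x.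
  by rewrite (fiber_comm fib).
(* In the first two clauses the excluded quadrant is avoided because its dimension is 2. *)
case=> [[gC dC]|[[gC dC]|[[gC [_ Cq]]|[gC [_ Cq]]]]].
- by apply: up => // Cq; move: dC; rewrite Cq sigma_mpE; apply: quadrant_dim.
- by apply: up' => // Cq; move: dC; rewrite Cq sigma_pmE; apply: quadrant_dim.
- exact: up.
- exact: up'.
Qed.
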